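(* Let $H,K,A,Q$ be functions on $\mathbb{Z}^2$ satisfying the discrete Demoulin system $$\begin{aligned} H_{12}&=-\frac{K(H-1)(K_2-1)}{K[H(H_1-1)(H_2-1)-(H-1)](K_2-1)-AQH_1K_2(H_2-1)},\\ K_{12}&=-\frac{H(K-1)(H_1-1)}{H[K(K_1-1)(K_2-1)-(K-1)](H_1-1)-AQH_1K_2(K_1-1)}, \end{aligned}\qquad A_2=\frac{H_1}{K}A,\quad Q_1=\frac{K_2}{H}Q,$$ let $\chi,\bar\chi$ satisfy $$\chi^2=\frac{(1-H)H_1}{(1-H_1)K},\qquad \bar\chi^2=\frac{(1-K)K_2}{(1-K_2)H},\qquad \chi_2\bar\chi H=\bar\chi_1\chi K,$$ and let $\tilde F=(\tilde r,\tilde r^1,\tilde r^2,\tilde r^{12})^T$ be a solution of the linear system $\tilde F_1=\tilde L\tilde F$, $\tilde F_2=\tilde M\tilde F$ with $$\tilde L=\chi\begin{pmatrix}1&1&0&0\\ A&A+\frac{H_1-1}{H_1(H-1)}&\frac{AK}{K-1}&\frac{AK}{K-1}\\ K-1&K-1&K&K\\ 0&\frac{(H_1-1)(K-1)}{H_1(H-1)}&0&\frac{(H_1-1)K}{H_1(H-1)}\end{pmatrix},$$ $$\tilde M=\bar\chi\begin{pmatrix}1&0&1&0\\ H-1&H&H-1&H\\ Q&\frac{QH}{H-1}&Q+\frac{K_2-1}{K_2(K-1)}&\frac{QH}{H-1}\\ 0&0&\frac{(K_2-1)(H-1)}{K_2(K-1)}&\frac{(K_2-1)H}{K_2(K-1)}\end{pmatrix}.$$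 Let $\kappa,\bar\kappa,\xi$ be nowhere vanishing functions with $$\xi_1=\frac{\kappa\xi}{\kappa_1K},\qquad \xi_2=\frac{\bar\kappa\xi}{\bar\kappa_2H},\qquad \kappa\bar\kappa=1,$$ and define $F=(r,r^1,r^2,r^{12})^T$ by $$\tilde F=GF,\qquad G=\begin{pmatrix}\xi&0&0&0\\ -\xi&\kappa&0&0\\ -\xi&0&\bar\kappa&0\\ \xi&-\kappa&-\bar\kappa&1/\xi\end{pmatrix}.$$ Then $F$ satisfies $F_1=LF$, $F_2=MF$ with $$L=\begin{pmatrix}0&1/\alpha&0&0\\ -\alpha&f+g&0&b\\ 0&0&0&1/\alpha\\ 0&a&-\alpha&f-g\end{pmatrix},\qquad M=\begin{pmatrix}0&0&1/\bar\alpha&0\\ 0&0&0&1/\bar\alpha\\ -\bar\alpha&0&\bar f+\bar g&\bar b\\ 0&-\bar\alpha&\bar a&\bar f-\bar g\end{pmatrix},$$ where $$\begin{aligned} a&=\frac{\chi\xi\kappa^2}{\kappa_1}\frac{A}{(1-K)K}, & \bar a&=\frac{\bar\chi\xi\bar\kappa^2}{\bar\kappa_2}\frac{Q}{(1-H)H}, & b&=\frac{\chi}{\xi\kappa_1}\frac{AK}{K-1}, & \bar b&=\frac{\bar\chi}{\xi\bar\kappa_2}\frac{QH}{H-1},\\ f&=\frac{\chi\kappa}{\kappa_1}\frac{1-HH_1}{(1-H)H_1}, & \bar f&=\frac{\bar\chi\bar\kappa}{\bar\kappa_2}\frac{1-KK_2}{(1-K)K_2}, & g&=\frac{\chi\kappa}{\kappa_1}\frac{A}{1-K},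 & \bar g&=\frac{\bar\chi\bar\kappa}{\bar\kappa_2}\frac{Q}{1-H},\\ \alpha&=\frac{\xi}{\chi\kappa_1K}, & \bar\alpha&=\frac{\xi}{\bar\chi\bar\kappa_2H}, \end{aligned}$$ and $$ab+g^2=0,\qquad \bar a\bar b+\bar g^2=0 .$$ That is, $F$ is the canonical frame associated with a discrete Demoulin surface.
   Context: For a function $h$ on $\mathbb{Z}^2$, $h_1(n_1,n_2)=h(n_1+1,n_2)$, $h_2(n_1,n_2)=h(n_1,n_2+1)$, $h_{12}$ both shifts, and $h_{\bar1},h_{\bar2}$ the inverse shifts; the superscripts on $r^1,r^2,r^{12}$ (and with tildes) are labels, and bars on letters such as $\bar a$ merely distinguish functions. All denominators are assumed non-zero; the frame $\tilde F$ is assumed non-degenerate (linearly independent rows in $\mathbb{R}^4$). A discrete asymptotic net is a map $\mathbb{Z}^2\to\mathbb{P}^3$ with homogeneous coordinates $r$ such that $r,r_1,r_2,r_{\bar1},r_{\bar2}$ are always coplanar. A canonical frame of such a net is a frame $F=(r,r^1,r^2,r^{12})^T$ with $r^1=\alpha r_1$, $r^2=\bar\alpha r_2$, $r^{12}=\gamma r_{12}$, $\gamma=\alpha\bar\alpha_1=\bar\alpha\alpha_2$, satisfying linear equations $F_1=LF$, $F_2=MF$ with $L,M$ of the displayed form. The net is a discrete Demoulin surface if it has a canonical frame for which $T=ab+g^2$ and $\bar T=\bar a\bar b+\bar g^2$ vanish identically. *)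

(* Defs.v *)
From mathcomp Require Import all_boot all_order all_algebra.
From mathcomp Require Import reals.

Set Implicit Arguments.
Unset Strict Implicit.
Unset Printing Implicit Defensive.

Import Order.TTheory GRing.Theory Num.Theory.
Local Open Scope ring_scope.

Notation lattice := (int * int)%type.

(* Shifts of lattice functions: [sh1 h], [sh2 h], [sh12 h] stand for h_1, h_2,
   h_12, and [shb1 h], [shb2 h] for the inverse shifts. *)
Definition sh1 (T : Type) (h : lattice -> T) : lattice -> T :=
  fun z => h (z.1 + 1, z.2).
Definition sh2 (T : Type) (h : lattice -> T) : lattice -> T :=
  fun z => h (z.1, z.2 + 1).
Definition sh12 (T : Type) (h : lattice -> T) : lattice -> T :=
  fun z => h (z.1 + 1, z.2 + 1).
Definition shb1 (T : Type) (h : lattice -> T) : lattice -> T :=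
  fun z => h (z.1 - 1, z.2).
Definition shb2 (T : Type) (h : lattice -> T) : lattice -> T :=
  fun z => h (z.1, z.2 - 1).

(* The 4 x 4 matrix displayed by a list of its rows. *)
Definition mx4 (R : realType) (rows : seq (seq R)) : 'M[R]_4 :=
  \matrix_(i < 4, j < 4) nth 0 (nth [::] rows i) j.

(* Points of P^3 are the lines through the origin of R^4. *)
Definition P3 (R : realType) : Type :=
  {U : {vspace 'rV[R]_4} | \dim U == 1%N}.

(* A family of vectors [r] gives homogeneous coordinates of the net [p];
   nonvanishing of [r] is automatic as [val (p z)] has dimension 1. *)
Definition homogeneous_coords (R : realType) (p : lattice -> P3 R)
    (r : lattice -> 'rV[R]_4) : Prop :=
  forall z, val (p z) = <[r z]>%VS.

(* Points are coplanar when some projective plane, i.e. some 3-dimensional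
   subspace of R^4, contains them all. *)
Definition coplanar (R : realType) (s : seq (P3 R)) : Prop :=
  (\dim (\sum_(x <- s) val x)%VS <= 3)%N.

Definition asymptotic_net (R : realType) (p : lattice -> P3 R) : Prop :=
  forall z, coplanar [:: p z; sh1 p z; sh2 p z; shb1 p z; shb2 p z].

Definition Lmx (R : realType) (alpha a b f g : R) : 'M[R]_4 :=
  mx4 [:: [:: 0;       alpha^-1; 0;       0       ];
          [:: - alpha; f + g;    0;       b       ];
          [:: 0;       0;        0;       alpha^-1];
          [:: 0;       a;        - alpha; f - g   ]].

Definition Mmx (R : realType) (alphab ab bb fb gb : R) : 'M[R]_4 :=
  mx4 [:: [:: 0;        0;        alphab^-1; 0        ];
          [:: 0;        0;        0;         alphab^-1];
          [:: - alphab; 0;        fb + gb;   bb       ];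
          [:: 0;        - alphab; ab;        fb - gb  ]].

(* The lattice function F = (r, r^1, r^2, r^12)^T is a canonical frame of the
   net [p]; the letters ending in [b] are the barred coefficients. *)
Definition canonical_frame (R : realType) (p : lattice -> P3 R)
    (alpha alphab a b f g ab bb fb gb : lattice -> R)
    (F : lattice -> 'M[R]_4) : Prop :=
  let r : lattice -> 'rV[R]_4 := fun z => row 0 (F z) in
  [/\ homogeneous_coords p r,
      forall z, row_free (F z),
      forall z, alpha z != 0 /\ alphab z != 0,
      forall z, row 1 (F z) = alpha z *: sh1 r z
             /\ row 2 (F z) = alphab z *: sh2 r z &
   [/\ forall z, alpha z * sh1 alphab z = alphab z * sh2 alpha z,
      forall z, row 3 (F z) = (alpha z * sh1 alphab z) *: sh12 r z,
      forall z, sh1 F z = Lmx (alpha z) (a z) (b z) (f z) (g z) *m F z &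
      forall z, sh2 F z = Mmx (alphab z) (ab z) (bb z) (fb z) (gb z) *m F z]].

Definition demoulin_invariant (R : realType) (a b g : R) : R := a * b + g ^+ 2.

Definition demoulin_surface (R : realType) (p : lattice -> P3 R) : Prop :=
  asymptotic_net p /\
  exists (alpha alphab a b f g ab bb fb gb : lattice -> R)
         (F : lattice -> 'M[R]_4),
    [/\ canonical_frame p alpha alphab a b f g ab bb fb gb F,
        forall z, demoulin_invariant (a z) (b z) (g z) = 0 &
        forall z, demoulin_invariant (ab z) (bb z) (gb z) = 0].

(* Denominators of the right-hand sides for H_12 and K_12; the second is the
   first with (H, H1, H2) and (K, K2, K1) exchanged. *)
Definition demoulin_den (R : realType) (H H1 H2 K K2 A Q : R) : R :=
  K * (H * (H1 - 1) * (H2 - 1) - (H - 1)) * (K2 - 1)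
  - A * Q * H1 * K2 * (H2 - 1).

Definition demoulin_denb (R : realType) (H H1 K K1 K2 A Q : R) : R :=
  H * (K * (K1 - 1) * (K2 - 1) - (K - 1)) * (H1 - 1)
  - A * Q * H1 * K2 * (K1 - 1).

Definition discrete_demoulin_system (R : realType)
    (H K A Q : lattice -> R) : Prop :=
  [/\ forall z, sh12 H z =
        - ((K z * (H z - 1) * (sh2 K z - 1))
           / demoulin_den (H z) (sh1 H z) (sh2 H z) (K z) (sh2 K z) (A z) (Q z)),
      forall z, sh12 K z =
        - ((H z * (K z - 1) * (sh1 H z - 1))
           / demoulin_denb (H z) (sh1 H z) (K z) (sh1 K z) (sh2 K z) (A z) (Q z)),
      forall z, sh2 A z = sh1 H z / K z * A z &
      forall z, sh1 Q z = sh2 K z / H z * Q z].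

Definition Ltilde (R : realType) (chi H H1 K A : R) : 'M[R]_4 :=
  let c := (H1 - 1) / (H1 * (H - 1)) in
  let d := A * K / (K - 1) in
  chi *: mx4 [:: [:: 1;     1;           0; 0    ];
                 [:: A;     A + c;       d; d    ];
                 [:: K - 1; K - 1;       K; K    ];
                 [:: 0;     c * (K - 1); 0; c * K]].

Definition Mtilde (R : realType) (chib H K K2 Q : R) : 'M[R]_4 :=
  let c := (K2 - 1) / (K2 * (K - 1)) in
  let d := Q * H / (H - 1) in
  chib *: mx4 [:: [:: 1;     0; 1;           0    ];
                  [:: H - 1; H; H - 1;       H    ];
                  [:: Q;     d; Q + c;       d    ];
                  [:: 0;     0; c * (H - 1); c * H]].

Definition gauge (R : realType) (xi kappa kappab : R) : 'M[R]_4 :=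
  mx4 [:: [:: xi;   0;       0;        0    ];
          [:: - xi; kappa;   0;        0    ];
          [:: - xi; 0;       kappab;   0    ];
          [:: xi;   - kappa; - kappab; xi^-1]].

(* Main.v *)
Require Import Defs.
From mathcomp Require Import all_boot all_order all_algebra.
From mathcomp Require Import reals.
From mathcomp Require Import perm ring.

(** Throughout, h_1, h_2 and h_12 are the shifts of a lattice function h.

    With L, M the transition matrices of the canonical frame and Lt, Mt those of
    Ft, substituting Ft = G F turns Ft_1 = Lt Ft into G_1 F_1 = Lt G F, so
    F_1 = L F follows from the matrix identity Lt G = G_1 L. This is a finite
    computation with rational functions, in which the shift equation for xi, the
    relation kappa kappab = 1 and the formula for chi^2 are used
    ([Ltilde_gauge]). Conjugating with the transposition of the two middle frame
    vectors turns it into the identity Mt G = G_2 M ([Mtilde_gauge]).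

    The equations F_1 = L F and F_2 = M F with F invertible, together with
    alpha alphab_1 = alphab alpha_2, make F a canonical frame of the net spanned
    by its first row ([canonical_frame_exists]), and any net with a canonical
    frame is asymptotic ([canonical_frame_asymptotic_net]). The relation between
    alpha and alphab compares the two ways of computing xi_12, given the
    relation between chi and chib. The invariants a b + g^2 and ab bb + gb^2
    cancel directly. *)

Set Implicit Arguments.
Unset Strict Implicit.
Unset Printing Implicit Defensive.

Import Order.TTheory GRing.Theory Num.Theory.
Local Open Scope ring_scope.

(** * Preliminaries on 4 x 4 matrices and lattice shifts *)

Ltac entrywise :=
  apply/matrixP;
  case=> [[|[|[|[|//]]]] ?]; case=> [[|[|[|[|//]]]] ?];
  rewrite !(mxE, big_ord_recl, big_ord0) /=.

Lemma sh1_shb1 (T : Type) (h : lattice -> T) (z : lattice) :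
  h (z.1 - 1 + 1, z.2) = h z.
Proof. by case: z => m n /=; rewrite subrK. Qed.

Lemma sh2_shb2 (T : Type) (h : lattice -> T) (z : lattice) :
  h (z.1, z.2 - 1 + 1) = h z.
Proof. by case: z => m n /=; rewrite subrK. Qed.

Lemma row_mx4M (R : realType) (rows : seq (seq R)) (F : 'M[R]_4) (i : 'I_4) :
  let c := nth 0 (nth [::] rows i) in
  row i (mx4 rows *m F) = c 0%N *: row 0 F + c 1%N *: row 1 F
                          + c 2%N *: row 2 F + c 3%N *: row 3 F.
Proof.
rewrite /= row_mul mulmx_sum_row !big_ord_recl big_ord0 !mxE /= addr0 !addrA.
by do ?[congr (_ + _)]; congr (_ *: row _ _); apply: val_inj.
Qed.

Lemma gauge_unit (R : realType) (xi kappa kappab : R) :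
  xi != 0 -> kappa != 0 -> kappab != 0 -> gauge xi kappa kappab \in unitmx.
Proof.
move=> xi0 k0 kb0.
pose G' : 'M[R]_4 := mx4 [:: [:: xi^-1;     0;         0;         0 ];
                             [:: kappa^-1;  kappa^-1;  0;         0 ];
                             [:: kappab^-1; 0;         kappab^-1; 0 ];
                             [:: xi;        xi;        xi;        xi]].
suff /mulmx1_unit [] : gauge xi kappa kappab *m G' = 1%:M by [].
by entrywise; field; rewrite ?xi0 ?k0 ?kb0.
Qed.

(** * The gauge transformation *)

Lemma chi_neq0 (R : realType) (chi H H1 K : R) :
  H != 1 -> H1 != 0 -> H1 != 1 -> K != 0 ->
  chi ^+ 2 = ((1 - H) * H1) / ((1 - H1) * K) -> chi != 0.
Proof.
move=> Hn1 H10 H1n1 K0 chiE.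
by rewrite -sqrf_eq0 chiE !mulf_neq0 ?invr_neq0 ?mulf_neq0 // subr_eq0 eq_sym.
Qed.

(** The equation for chi^2 is what matches the three entries of the right-hand
    side in which alpha, rather than its inverse, occurs: it turns alpha, which
    has chi in the denominator, into an expression linear in chi. All other
    entries agree as rational functions. *)
Lemma Ltilde_gauge (R : realType) (chi H H1 K A xi kappa kappa1 : R) :
  H != 0 -> H != 1 -> H1 != 0 -> H1 != 1 -> K != 0 -> K != 1 ->
  chi ^+ 2 = ((1 - H) * H1) / ((1 - H1) * K) ->
  xi != 0 -> kappa != 0 -> kappa1 != 0 ->
  Ltilde chi H H1 K A *m gauge xi kappa kappa^-1 =
  gauge ((kappa * xi) / (kappa1 * K)) kappa1 kappa1^-1 *m
  Lmx (xi / (chi * kappa1 * K))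
      ((chi * xi * kappa ^+ 2) / kappa1 * (A / ((1 - K) * K)))
      (chi / (xi * kappa1) * ((A * K) / (K - 1)))
      ((chi * kappa) / kappa1 * ((1 - H * H1) / ((1 - H) * H1)))
      ((chi * kappa) / kappa1 * (A / (1 - K))).
Proof.
move=> H0 Hn1 H10 H1n1 K0 Kn1 chiE xi0 k0 k10.
have chi0 := chi_neq0 Hn1 H10 H1n1 K0 chiE.
have Hs : H - 1 != 0 by rewrite subr_eq0.
have Hs' : 1 - H != 0 by rewrite subr_eq0 eq_sym.
have H1s : H1 - 1 != 0 by rewrite subr_eq0.
have H1s' : 1 - H1 != 0 by rewrite subr_eq0 eq_sym.
have Ks : K - 1 != 0 by rewrite subr_eq0.
have Ks' : 1 - K != 0 by rewrite subr_eq0 eq_sym.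
have nz := (H0, Hs, Hs', H10, H1s, H1s', K0, Ks, Ks', xi0, k0, k10, chi0).
have alphaE : xi / (chi * kappa1 * K)
              = chi * xi * ((H1 - 1) / (H1 * (H - 1))) / kappa1.
  have -> : xi / (chi * kappa1 * K) = chi * xi / (chi ^+ 2 * kappa1 * K).
    by field; rewrite !nz.
  by rewrite chiE; field; rewrite !nz.
entrywise;
  first [by field; rewrite ?nz | by rewrite alphaE; field; rewrite ?nz].
Qed.

Definition swap12 (R : realType) (B : 'M[R]_4) : 'M[R]_4 :=
  \matrix_(i, j) B (tperm 1 2 i) (tperm 1 2 j).

Lemma swap12M (R : realType) (B C : 'M[R]_4) :
  swap12 (B *m C) = swap12 B *m swap12 C.
Proof.
apply/matrixP=> i j; rewrite !mxE (reindex_inj (@perm_inj _ (tperm 1 2))).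
by apply: eq_bigr => k _; rewrite !mxE.
Qed.

Lemma swap12_gauge (R : realType) (xi kappa kappab : R) :
  swap12 (gauge xi kappa kappab) = gauge xi kappab kappa.
Proof. by entrywise; rewrite !permE. Qed.

Lemma swap12_Lmx (R : realType) (alpha a b f g : R) :
  swap12 (Lmx alpha a b f g) = Mmx alpha a b f g.
Proof. by entrywise; rewrite !permE. Qed.

Lemma swap12_Ltilde (R : realType) (chi H H1 K A : R) :
  swap12 (Ltilde chi H H1 K A) = Mtilde chi K H H1 A.
Proof. by entrywise; rewrite !permE. Qed.

(** Exchanging the two lattice directions exchanges H with K, A with Q and the
    two middle vectors of the frame, so this is [Ltilde_gauge] conjugated by a
    transposition of the basis. *)
Lemma Mtilde_gauge (R : realType) (chib H K K2 Q xi kappab kappab2 : R) :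
  H != 0 -> H != 1 -> K != 0 -> K != 1 -> K2 != 0 -> K2 != 1 ->
  chib ^+ 2 = ((1 - K) * K2) / ((1 - K2) * H) ->
  xi != 0 -> kappab != 0 -> kappab2 != 0 ->
  Mtilde chib H K K2 Q *m gauge xi kappab^-1 kappab =
  gauge ((kappab * xi) / (kappab2 * H)) kappab2^-1 kappab2 *m
  Mmx (xi / (chib * kappab2 * H))
      ((chib * xi * kappab ^+ 2) / kappab2 * (Q / ((1 - H) * H)))
      (chib / (xi * kappab2) * ((Q * H) / (H - 1)))
      ((chib * kappab) / kappab2 * ((1 - K * K2) / ((1 - K) * K2)))
      ((chib * kappab) / kappab2 * (Q / (1 - H))).
Proof.
move=> H0 Hn1 K0 Kn1 K20 K2n1 chibE xi0 kb0 kb20.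
have /(congr1 (@swap12 R)) :=
  Ltilde_gauge Q K0 Kn1 K20 K2n1 H0 Hn1 chibE xi0 kb0 kb20.
by rewrite !swap12M !swap12_gauge swap12_Ltilde swap12_Lmx.
Qed.

(** The gauge transformation law of transition matrices, C = G1^-1 B G. *)
Lemma gauge_frame (R : realType) (B C G G1 F F1 : 'M[R]_4) :
  G1 \in unitmx -> B *m G = G1 *m C ->
  G1 *m F1 = B *m (G *m F) -> F1 = C *m F.
Proof.
move=> G1u BG eqF; apply: (can_inj (mulKmx G1u)).
by rewrite eqF mulmxA BG mulmxA.
Qed.

(** * Canonical frames and asymptotic nets *)

(** From F_1 = L F one reads r_1 = r^1 / alpha and r^2_1 = r^12 / alpha; the
    latter, with r^2_1 = alphab_1 r_12, gives r^12. *)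
Lemma canonical_frame_exists (R : realType)
    (alpha alphab a b f g ab bb fb gb : lattice -> R)
    (F : lattice -> 'M[R]_4) :
  (forall z, row_free (F z)) ->
  (forall z, alpha z != 0 /\ alphab z != 0) ->
  (forall z, alpha z * sh1 alphab z = alphab z * sh2 alpha z) ->
  (forall z, sh1 F z = Lmx (alpha z) (a z) (b z) (f z) (g z) *m F z) ->
  (forall z, sh2 F z = Mmx (alphab z) (ab z) (bb z) (fb z) (gb z) *m F z) ->
  exists p : lattice -> P3 R,
    canonical_frame p alpha alphab a b f g ab bb fb gb F.
Proof.
move=> Ffree alpha0 alphaC F1 F2.
pose r z := row 0 (F z).
have r_neq0 z : r z != 0.
  have /row_freeP[F' FF'] := Ffree z; apply/eqP => r0.
  have /rowP/(_ 0) : row 0 (F z *m F') = 0.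
    by rewrite row_mul -[row 0 (F z)]/(r z) r0 mul0mx.
  by rewrite FF' !mxE /= => /eqP; rewrite oner_eq0.
have dim_r z : \dim <[r z]>%VS == 1%N by rewrite dim_vline r_neq0.
have r1E z : row 1 (F z) = alpha z *: row 0 (sh1 F z).
  have [al0 _] := alpha0 z.
  by rewrite F1 row_mx4M /= !scale0r !addr0 add0r scalerA divff ?scale1r.
have r2E z : row 2 (F z) = alphab z *: row 0 (sh2 F z).
  have [_ alb0] := alpha0 z.
  by rewrite F2 row_mx4M /= !scale0r !addr0 !add0r scalerA divff ?scale1r.
exists (fun z => exist _ <[r z]>%VS (dim_r z)).
split=> //; split=> // z.
have [al0 _] := alpha0 z.
rewrite -scalerA -[X in _ = _ *: X](r2E (z.1 + 1, z.2)) -/(sh1 F z) F1.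
by rewrite row_mx4M /= !scale0r !add0r scalerA divff ?scale1r.
Qed.

(** The plane at r is spanned by r, r^1, r^2. It contains the forward neighbours
    since r_1, r_2 are multiples of r^1, r^2. At the vertex before z in
    direction 1, the second row of F_1 = L F is a relation between r^1, the
    previous r, and the previous r^1 and r^12; the first and third rows identify
    the last two with multiples of r and r^2. So the backward neighbour lies in
    the plane as well, and likewise in direction 2. *)
Lemma canonical_frame_asymptotic_net (R : realType) (p : lattice -> P3 R)
    (alpha alphab a b f g ab bb fb gb : lattice -> R)
    (F : lattice -> 'M[R]_4) :
  canonical_frame p alpha alphab a b f g ab bb fb gb F -> asymptotic_net p.
Proof.
move=> [pr _ alpha0 _ [_ _ F1 F2]] z.
pose X := [:: row 0 (F z); row 1 (F z); row 2 (F z)].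
have X0 : row 0 (F z) \in <<X>>%VS by rewrite memv_span ?inE ?eqxx.
have X1 : row 1 (F z) \in <<X>>%VS by rewrite memv_span ?inE ?eqxx ?orbT.
have X2 : row 2 (F z) \in <<X>>%VS by rewrite memv_span ?inE ?eqxx ?orbT.
rewrite /coplanar; apply: (leq_trans _ (dim_span X)); apply: dimvS.
rewrite !big_cons big_nil addv0 !subv_add !pr -!memvE X0 /=.
have memF1 : row 0 (sh1 F z) \in <<X>>%VS.
  by rewrite F1 row_mx4M /= !rpredD // ?scale0r ?mem0v ?rpredZ.
have memF2 : row 0 (sh2 F z) \in <<X>>%VS.
  by rewrite F2 row_mx4M /= !rpredD // ?scale0r ?mem0v ?rpredZ.
rewrite memF1 memF2 /=.
apply/andP; split.
- set w := (z.1 - 1, z.2).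
  have [al0 _] := alpha0 w.
  have := F1 w; rewrite /sh1 /= sh1_shb1 => Fz.
  have := congr1 (row 0) Fz; have := congr1 (row 1) Fz.
  have := congr1 (row 2) Fz.
  rewrite !row_mx4M /= !scale0r !(addr0, add0r) => r2w r1w r0w.
  have w1 : row 1 (F w) \in <<X>>%VS.
    by rewrite -(scalerKV al0 (row 1 _)) -r0w rpredZ.
  have w3 : row 3 (F w) \in <<X>>%VS.
    by rewrite -(scalerKV al0 (row 3 _)) -r2w rpredZ.
  have nal0 : - alpha w != 0 by rewrite oppr_eq0.
  rewrite -(scalerK nal0 (row 0 _)).
  have -> : - alpha w *: row 0 (F w)
            = row 1 (F z) - b w *: row 3 (F w) - (f w + g w) *: row 1 (F w).
    by rewrite r1w !addrK.
  by rewrite rpredZ ?rpredB ?rpredZ.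
- set w := (z.1, z.2 - 1).
  have [_ al0] := alpha0 w.
  have := F2 w; rewrite /sh2 /= sh2_shb2 => Fz.
  have := congr1 (row 0) Fz; have := congr1 (row 1) Fz.
  have := congr1 (row 2) Fz.
  rewrite !row_mx4M /= !scale0r !(addr0, add0r) => r2w r1w r0w.
  have w2 : row 2 (F w) \in <<X>>%VS.
    by rewrite -(scalerKV al0 (row 2 _)) -r0w rpredZ.
  have w3 : row 3 (F w) \in <<X>>%VS.
    by rewrite -(scalerKV al0 (row 3 _)) -r1w rpredZ.
  have nal0 : - alphab w != 0 by rewrite oppr_eq0.
  rewrite -(scalerK nal0 (row 0 _)).
  have -> : - alphab w *: row 0 (F w)
            = row 2 (F z) - bb w *: row 3 (F w) - (fb w + gb w) *: row 2 (F w).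
    by rewrite r2w !addrK.
  by rewrite rpredZ ?rpredB ?rpredZ.
Qed.

(** * The Demoulin surface *)

Theorem mainTheorem8 (R : realType)
  (H K A Q chi chib kappa kappab xi : lattice -> R)
  (Ft F : lattice -> 'M[R]_4)
  (* non-vanishing of the denominators *)
  (H_neq0 : forall z, H z != 0) (H_neq1 : forall z, H z != 1)
  (K_neq0 : forall z, K z != 0) (K_neq1 : forall z, K z != 1)
  (den_neq0 : forall z,
    demoulin_den (H z) (sh1 H z) (sh2 H z) (K z) (sh2 K z) (A z) (Q z) != 0)
  (denb_neq0 : forall z,
    demoulin_denb (H z) (sh1 H z) (K z) (sh1 K z) (sh2 K z) (A z) (Q z) != 0)
  (demoulinHKAQ : discrete_demoulin_system H K A Q)
  (chiE : forall z,
    chi z ^+ 2 = ((1 - H z) * sh1 H z) / ((1 - sh1 H z) * K z))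
  (chibE : forall z,
    chib z ^+ 2 = ((1 - K z) * sh2 K z) / ((1 - sh2 K z) * H z))
  (chi_chib : forall z,
    sh2 chi z * chib z * H z = sh1 chib z * chi z * K z)
  (Ft_nondegenerate : forall z, row_free (Ft z))
  (Ft1 : forall z,
    sh1 Ft z = Ltilde (chi z) (H z) (sh1 H z) (K z) (A z) *m Ft z)
  (Ft2 : forall z,
    sh2 Ft z = Mtilde (chib z) (H z) (K z) (sh2 K z) (Q z) *m Ft z)
  (kappa_neq0 : forall z, kappa z != 0)
  (kappab_neq0 : forall z, kappab z != 0)
  (xi_neq0 : forall z, xi z != 0)
  (xi1 : forall z, sh1 xi z = (kappa z * xi z) / (sh1 kappa z * K z))
  (xi2 : forall z, sh2 xi z = (kappab z * xi z) / (sh2 kappab z * H z))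
  (kappa_kappab : forall z, kappa z * kappab z = 1)
  (FtE : forall z, Ft z = gauge (xi z) (kappa z) (kappab z) *m F z) :
  let a := fun z => (chi z * xi z * kappa z ^+ 2) / sh1 kappa z
                    * (A z / ((1 - K z) * K z)) in
  let ab := fun z => (chib z * xi z * kappab z ^+ 2) / sh2 kappab z
                     * (Q z / ((1 - H z) * H z)) in
  let b := fun z => chi z / (xi z * sh1 kappa z)
                    * ((A z * K z) / (K z - 1)) in
  let bb := fun z => chib z / (xi z * sh2 kappab z)
                     * ((Q z * H z) / (H z - 1)) in
  let f := fun z => (chi z * kappa z) / sh1 kappa z
                    * ((1 - H z * sh1 H z) / ((1 - H z) * sh1 H z)) in
  let fb := fun z => (chib z * kappab z) / sh2 kappab z
                     * ((1 - K z * sh2 K z) / ((1 - K z) * sh2 K z)) in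
  let g := fun z => (chi z * kappa z) / sh1 kappa z * (A z / (1 - K z)) in
  let gb := fun z => (chib z * kappab z) / sh2 kappab z
                     * (Q z / (1 - H z)) in
  let alpha := fun z => xi z / (chi z * sh1 kappa z * K z) in
  let alphab := fun z => xi z / (chib z * sh2 kappab z * H z) in
  [/\ forall z, sh1 F z = Lmx (alpha z) (a z) (b z) (f z) (g z) *m F z,
      forall z, sh2 F z = Mmx (alphab z) (ab z) (bb z) (fb z) (gb z) *m F z,
      forall z, a z * b z + g z ^+ 2 = 0,
      forall z, ab z * bb z + gb z ^+ 2 = 0 &
      exists p : lattice -> P3 R,
        demoulin_surface p
        /\ canonical_frame p alpha alphab a b f g ab bb fb gb F].

Proof.
move=> a ab b bb f fb g gb alpha alphab.
have kbE z : kappab z = (kappa z)^-1.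
  by rewrite -[RHS]mulr1 -(kappa_kappab z) mulKf.
have kE z : kappa z = (kappab z)^-1 by rewrite kbE invrK.
have Gu z : gauge (xi z) (kappa z) (kappab z) \in unitmx.
  exact: gauge_unit.
have chi0 z : chi z != 0 by apply: chi_neq0 (chiE z) => //; rewrite /sh1.
have chib0 z : chib z != 0 by apply: chi_neq0 (chibE z) => //; rewrite /sh2.
have F1 z : sh1 F z = Lmx (alpha z) (a z) (b z) (f z) (g z) *m F z.
  have := Ft1 z; rewrite {1}/sh1 !FtE; apply: gauge_frame; first exact: Gu.
  rewrite -/(sh1 xi z) xi1 !kbE.
  by apply: Ltilde_gauge => //; rewrite /sh1.
have F2 z : sh2 F z = Mmx (alphab z) (ab z) (bb z) (fb z) (gb z) *m F z.
  have := Ft2 z; rewrite {1}/sh2 !FtE; apply: gauge_frame; first exact: Gu.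
  rewrite -/(sh2 xi z) xi2 !kE.
  by apply: Mtilde_gauge => //; rewrite /sh2.
have T0 z : a z * b z + g z ^+ 2 = 0.
  rewrite /a /b /g; field.
  by rewrite xi_neq0 K_neq0 /sh1 kappa_neq0 !subr_eq0 K_neq1 eq_sym K_neq1.
have Tb0 z : ab z * bb z + gb z ^+ 2 = 0.
  rewrite /ab /bb /gb; field.
  by rewrite xi_neq0 H_neq0 /sh2 kappab_neq0 !subr_eq0 H_neq1 eq_sym H_neq1.
have Ffree z : row_free (F z).
  rewrite row_free_unit; have := Ft_nondegenerate z.
  by rewrite FtE row_free_unit unitmx_mul => /andP[].
have alpha0 z : alpha z != 0 /\ alphab z != 0.
  by split; rewrite /alpha /alphab /sh1 /sh2 !mulf_neq0 ?invr_neq0 ?mulf_neq0.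
(* Evaluating xi_12 along either path around the elementary square gives
   alpha alphab_1 = xi xi_12 / (chib_1 chi K) and
   alphab alpha_2 = xi xi_12 / (chi_2 chib H). *)
have alphaC z : alpha z * sh1 alphab z = alphab z * sh2 alpha z.
  transitivity (xi z * sh12 xi z / (sh1 chib z * chi z * K z)).
    rewrite [sh12 xi z](xi2 (z.1 + 1, z.2)) /alpha /alphab /sh1 /sh2 /= !kbE.
    by field; rewrite ?(kappa_neq0, H_neq0, K_neq0, chi0, chib0).
  rewrite -chi_chib [sh12 xi z](xi1 (z.1, z.2 + 1)).
  rewrite /alpha /alphab /sh1 /sh2 /= !kbE.
  by field; rewrite ?(kappa_neq0, H_neq0, K_neq0, chi0, chib0).
have [p pF] := canonical_frame_exists Ffree alpha0 alphaC F1 F2.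
split=> //; exists p; split=> //; split.
  exact: canonical_frame_asymptotic_net pF.
by exists alpha, alphab, a, b, f, g, ab, bb, fb, gb, F.
Qed.
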